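(* Let $K\in\mathbb{N}$ with $K\geq 2$. Let $\varepsilon>0$ be a real number, let $\gamma$ be a nonzero real number, and let $h:\mathbb{C}\to\mathbb{C}$ be continuous. If $$\lim_{|z|\to\infty}\frac{h(z)}{|z|^3}=0,$$ then the equation $$\varepsilon\Delta_k^2u(k-1)+\gamma|u(k)|^2u(k)=h(u(k)),\qquad k\in\mathbb{Z},$$ has a $K$-periodic solution $u:\mathbb{Z}\to\mathbb{C}$.
   Context: Here $|\cdot|$ is the modulus on $\mathbb{C}$. For $u:\mathbb{Z}\to\mathbb{C}$, $\Delta_k$ is the forward difference operator $(\Delta_k u)(k)=u(k+1)-u(k)$, so that $\Delta_k^2u(k-1)=u(k+1)-2u(k)+u(k-1)$. A function $u:\mathbb{Z}\to\mathbb{C}$ is $K$-periodic if $u(k+K)=u(k)$ for all $k\in\mathbb{Z}$. *)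

(* Defs.v *)
(* Stdlib reals and Coquelicot's complex numbers. *)
From Stdlib Require Import Reals ZArith Lra.
From Coquelicot Require Import Coquelicot.

Local Open Scope C_scope.

Definition fwd_diff (u : Z -> C) (k : Z) : C := u (k + 1)%Z - u k.

Definition periodic (K : nat) (u : Z -> C) : Prop :=
  forall k : Z, u (k + Z.of_nat K)%Z = u k.

(* The filter "|z| -> oo" on C, the analogue of Coquelicot's
   [Rbar_locally p_infty] on R. *)
Definition C_infty : (C -> Prop) -> Prop :=
  fun P => exists M : R, forall z : C, (M < Cmod z)%R -> P z.

Global Instance C_infty_filter : ProperFilter C_infty.
Proof.
split.
- intros P [M HM].
  exists (RtoC (Rabs M + 1)).
  apply HM.
  rewrite Cmod_R.
  pose proof (Rle_abs M).
  pose proof (Rle_abs (Rabs M + 1)).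
  lra.
- split.
  + now exists 0%R.
  + intros P Q [M HM] [N HN].
    exists (Rmax M N).
    intros z Hz.
    split; [apply HM | apply HN].
    * exact (Rle_lt_trans _ _ _ (Rmax_l M N) Hz).
    * exact (Rle_lt_trans _ _ _ (Rmax_r M N) Hz).
  + intros P Q HPQ [M HM].
    exists M; intros z Hz; apply HPQ, HM, Hz.
Qed.

Lemma fwd_diff2_pred (u : Z -> C) (k : Z) :
  fwd_diff (fwd_diff u) (k - 1)%Z = u (k + 1)%Z - 2 * u k + u (k - 1)%Z.
Proof.
unfold fwd_diff.
replace (k - 1 + 1)%Z with k by ring.
ring.
Qed.

(* Main.v *)
Require Import Defs.
From Stdlib Require Import Reals ZArith Lra Lia List Bool Classical ClassicalEpsilon.
From Coquelicot Require Import Coquelicot.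

(** A constant sequence is [K]-periodic and has zero second difference, so it
    suffices to solve the single equation [gamma * |z|^2 * z = h z] in [C].
    Dividing by [gamma], this asks for a common zero of the two real functions
    [(x^2 + y^2) * x - Re (h z) / gamma] and
    [(x^2 + y^2) * y - Im (h z) / gamma] of [z = x + i y].  Because [h] grows
    slower than the cube, on the boundary of a large square [[-M, M]^2] the
    cubic terms dominate: the first function is nonpositive on the left side
    and nonnegative on the right side, the second one is nonpositive on the
    bottom and nonnegative on the top.  A common zero is then given by the
    planar Poincare-Miranda theorem ([poincare_miranda]).

    That theorem rests on its discrete form ([mixed_cell]): if the nodes of a
    grid carry two boolean labels, one separating the left side from the right
    side and the other the bottom from the top, then some unit cell carries
    both values of both labels.  The discrete form is a parity argument.
    Call an edge a crossing if the first label is [false] at both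
    ends while the second label differs between them.  Crossings
    summed modulo 2 along the boundary of the grid equal the sum over
    all cells of their own boundary sums ([stokes_mod2]); the former is odd, so
    some cell has an odd boundary sum, and such a cell carries all label
    values.  Labelling by signs and using the compactness of the rectangle, a
    pair without common zero would admit a grid so fine that on each cell one
    of the two functions keeps a strict sign, contradicting [mixed_cell]. *)

(** * Parity on a grid *)

Fixpoint xor_sum (n : nat) (s : nat -> bool) : bool :=
  match n with
  | O => false
  | S m => xorb (xor_sum m s) (s m)
  end.

Lemma xor_sum_false (n : nat) (s : nat -> bool) :
  (forall i, (i < n)%nat -> s i = false) -> xor_sum n s = false.
Proof.
  induction n as [|n IH]; simpl; intros Hs; [reflexivity|].
  rewrite IH, Hs by auto with arith. reflexivity.
Qed.

Lemma xor_sum_telescope (n : nat) (s t : nat -> bool) :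
  (forall i, (i < n)%nat -> s i = xorb (t i) (t (S i))) ->
  xor_sum n s = xorb (t O) (t n).
Proof.
  induction n as [|n IH]; simpl; intros Hs.
  - now rewrite xorb_nilpotent.
  - rewrite IH, Hs by auto with arith.
    now destruct (t O), (t n), (t (S n)).
Qed.

(** Each interior edge belongs to two cells, so modulo 2 only the boundary of
    the grid survives when the cells are added up.  Here [hor i j] is the edge
    from [(i, j)] to [(i+1, j)] and [ver i j] the edge from [(i, j)] to
    [(i, j+1)]. *)
Lemma stokes_mod2 (m n : nat) (hor ver : nat -> nat -> bool) :
  (forall i j, (i < m)%nat -> (j < n)%nat ->
     xorb (xorb (hor i j) (ver (S i) j)) (xorb (hor i (S j)) (ver i j))
     = false) ->
  xorb (xor_sum m (fun i => hor i O)) (xor_sum n (ver m))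
  = xorb (xor_sum m (fun i => hor i n)) (xor_sum n (ver O)).
Proof.
  intros Hcell.
  assert (Hrow : forall j, (j < n)%nat ->
    xorb (xor_sum m (fun i => hor i j)) (xor_sum m (fun i => hor i (S j)))
    = xorb (ver O j) (ver m j)).
  { intros j Hj.
    assert (Hi : forall i, (i < m)%nat -> xorb (hor i j) (hor i (S j))
              = xorb (ver i j) (ver (S i) j)).
    { intros i Hi. specialize (Hcell i j Hi Hj).
      destruct (hor i j), (ver (S i) j), (hor i (S j)), (ver i j);
        simpl in *; congruence. }
    rewrite <- (xor_sum_telescope m _ (fun i => ver i j) Hi).
    clear. induction m as [|m IH]; simpl; [reflexivity|].
    rewrite <- IH.
    now destruct (xor_sum m (fun i => hor i j)),
      (xor_sum m (fun i => hor i (S j))), (hor m j), (hor m (S j)). }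
  clear Hcell.
  induction n as [|n IH]; simpl.
  - reflexivity.
  - specialize (Hrow n (Nat.lt_succ_diag_r n)) as Hn.
    specialize (IH (fun j Hj => Hrow j (Nat.lt_lt_succ_r _ _ Hj))).
    revert IH Hn.
    generalize (xor_sum m (fun i => hor i O)) (xor_sum m (fun i => hor i n))
      (xor_sum m (fun i => hor i (S n))) (xor_sum n (ver m))
      (xor_sum n (ver O)) (ver O n) (ver m n).
    intros [] [] [] [] [] [] []; simpl; congruence.
Qed.

Definition corners {A : Type} (l : nat -> nat -> A) (i j : nat) : list A :=
  l i j :: l (S i) j :: l (S i) (S j) :: l i (S j) :: nil.

Definition crossing (l1 b1 l2 b2 : bool) : bool :=
  negb l1 && negb l2 && xorb b1 b2.

(** If the first label is constantly [true], or the second one is constant,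
    the cell has no crossing; if the first label is constantly [false], the
    changes of the second label around the cell cancel.  So an odd number of
    crossings forces both labels to vary. *)
Lemma odd_cell (l1 l2 l3 l4 b1 b2 b3 b4 : bool) :
  xorb (xorb (crossing l1 b1 l2 b2) (crossing l2 b2 l3 b3))
       (xorb (crossing l4 b4 l3 b3) (crossing l1 b1 l4 b4)) = true ->
  (forall v, In v (l1 :: l2 :: l3 :: l4 :: nil)) /\
  (forall v, In v (b1 :: b2 :: b3 :: b4 :: nil)).
Proof.
  destruct l1, l2, l3, l4; try discriminate;
    destruct b1, b2, b3, b4; try discriminate;
    intros _; split; intros []; simpl; tauto.
Qed.

(** Only the right side has an odd number of crossings: on the left side the
    first label is [true], on the bottom and on the top the second label is
    constant, and along the right side it passes from [true] to [false]. *)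
Lemma mixed_cell (m n : nat) (L B : nat -> nat -> bool)
    (HL0 : forall j, (j <= n)%nat -> L O j = true)
    (HLm : forall j, (j <= n)%nat -> L m j = false)
    (HB0 : forall i, (i <= m)%nat -> B i O = true)
    (HBn : forall i, (i <= m)%nat -> B i n = false) :
  exists i j, (i < m)%nat /\ (j < n)%nat /\
    (forall v, In v (corners L i j)) /\ (forall v, In v (corners B i j)).
Proof.
  apply NNPP; intros Hno.
  set (hor := fun i j => crossing (L i j) (B i j) (L (S i) j) (B (S i) j)).
  set (ver := fun i j => crossing (L i j) (B i j) (L i (S j)) (B i (S j))).
  assert (Hst := stokes_mod2 m n hor ver).
  rewrite (xor_sum_false m (fun i => hor i O)) in Hst.
  2:{ intros i Hi. unfold hor, crossing. rewrite !HB0 by lia.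
      apply andb_false_r. }
  rewrite (xor_sum_false m (fun i => hor i n)) in Hst.
  2:{ intros i Hi. unfold hor, crossing. rewrite !HBn by lia.
      apply andb_false_r. }
  rewrite (xor_sum_false n (ver O)) in Hst.
  2:{ intros j Hj. unfold ver, crossing. now rewrite !HL0 by lia. }
  rewrite (xor_sum_telescope n (ver m) (B m)) in Hst.
  2:{ intros j Hj. unfold ver, crossing. now rewrite !HLm by lia. }
  rewrite HB0, HBn in Hst by lia.
  discriminate Hst.
  intros i j Hi Hj.
  apply not_true_is_false; intros Hodd.
  destruct (odd_cell _ _ _ _ _ _ _ _ Hodd) as [HL HB].
  apply Hno. exists i, j. auto.
Qed.

(** * The planar Poincare-Miranda theorem *)

Local Open Scope R_scope.

Definition node (a b : R) (n i : nat) : R := a + INR i * ((b - a) / INR n).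

Lemma node_0 (a b : R) (n : nat) : node a b n 0 = a.
Proof. unfold node; simpl; ring. Qed.

Lemma node_n (a b : R) (n : nat) : (0 < n)%nat -> node a b n n = b.
Proof.
  intros Hn. unfold node. field. apply not_0_INR. lia.
Qed.

Lemma node_bounds (a b : R) (n i : nat) :
  a <= b -> (0 < n)%nat -> (i <= n)%nat -> a <= node a b n i <= b.
Proof.
  intros Hab Hn Hi.
  assert (Hn' := lt_0_INR _ Hn). assert (Hi' := le_INR _ _ Hi).
  assert (H0 := pos_INR i).
  assert (Hq : 0 <= (b - a) / INR n) by (apply Rdiv_le_0_compat; lra).
  assert (Hb : b = a + INR n * ((b - a) / INR n)) by (field; lra).
  unfold node. split; [nra|]. rewrite Hb at 2. nra.
Qed.

Lemma node_S (a b : R) (n i : nat) :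
  node a b n (S i) = node a b n i + (b - a) / INR n.
Proof. unfold node; rewrite S_INR; ring. Qed.

(** The sign of [v] attached to the index [i], where [true] stands for
    nonpositive.  A zero value has both signs; at the two end indices the
    required one is imposed. *)
Definition low (n i : nat) (v : R) : bool :=
  if Nat.eqb i 0 then true
  else if Nat.eqb i n then false
  else if Rle_dec v 0 then true else false.

Lemma low_true (n i : nat) (v : R) :
  (i = O -> v <= 0) -> low n i v = true -> v <= 0.
Proof.
  unfold low. destruct (Nat.eqb_spec i 0); [auto|].
  destruct (Nat.eqb i n); [discriminate|].
  destruct (Rle_dec v 0); [auto|discriminate].
Qed.

Lemma low_false (n i : nat) (v : R) :
  (i = n -> 0 <= v) -> low n i v = false -> 0 <= v.
Proof.
  unfold low. destruct (Nat.eqb i 0); [discriminate|].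
  destruct (Nat.eqb_spec i n); [auto|].
  destruct (Rle_dec v 0); [discriminate|intros; lra].
Qed.

Lemma low_0 (n : nat) (v : R) : low n 0 v = true.
Proof. reflexivity. Qed.

Lemma low_n (n : nat) (v : R) : (0 < n)%nat -> low n n v = false.
Proof.
  intros Hn. unfold low. rewrite Nat.eqb_refl.
  destruct (Nat.eqb_spec n 0); [lia|reflexivity].
Qed.

Lemma sign_locally_constant (f : R -> R -> R) (u v : R) :
  continuity_2d_pt f u v -> f u v <> 0 ->
  locally_2d (fun x y => 0 < f x y * f u v) u v.
Proof.
  intros Hf Hne.
  destruct (Hf (mkposreal _ (Rabs_pos_lt _ Hne))) as [d Hd].
  exists d. intros x y Hx Hy. specialize (Hd x y Hx Hy). simpl in Hd.
  revert Hd. unfold Rabs.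
  destruct (Rcase_abs (f x y - f u v)), (Rcase_abs (f u v)); nra.
Qed.

Lemma no_common_sign (s t w : R) :
  s <= 0 -> 0 <= t -> 0 < s * w -> 0 < t * w -> False.
Proof. intros Hs Ht Hsw Htw. destruct (Rle_lt_dec w 0); nra. Qed.

Lemma in_corners {A : Type} (l : nat -> nat -> A) (i j : nat) (w : A) :
  In w (corners l i j) ->
  exists p q, (p = i \/ p = S i) /\ (q = j \/ q = S j) /\ l p q = w.
Proof.
  intros [H|[H|[H|[H|[]]]]]; eauto 10.
Qed.

Theorem poincare_miranda (f g : R -> R -> R) (a b c d : R)
    (Hab : a <= b) (Hcd : c <= d)
    (Hf : forall x y, a <= x <= b -> c <= y <= d -> continuity_2d_pt f x y)
    (Hg : forall x y, a <= x <= b -> c <= y <= d -> continuity_2d_pt g x y)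
    (Hleft : forall y, c <= y <= d -> f a y <= 0)
    (Hright : forall y, c <= y <= d -> 0 <= f b y)
    (Hbottom : forall x, a <= x <= b -> g x c <= 0)
    (Htop : forall x, a <= x <= b -> 0 <= g x d) :
  exists x y, a <= x <= b /\ c <= y <= d /\ f x y = 0 /\ g x y = 0.
Proof.
  apply NNPP; intros Hno.
  (* The radius is halved so that a cell of diameter at most [delta u v] with
     one node [delta u v]-close to [(u, v)] still lies in the neighbourhood. *)
  assert (Hdelta : forall u v, exists delta : posreal,
    a <= u <= b -> c <= v <= d ->
    (forall x y, Rabs (x - u) < 2 * delta -> Rabs (y - v) < 2 * delta ->
       0 < f x y * f u v) \/
    (forall x y, Rabs (x - u) < 2 * delta -> Rabs (y - v) < 2 * delta ->
       0 < g x y * g u v)).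
  { intros u v.
    destruct (classic ((a <= u <= b) /\ (c <= v <= d))) as [[Hu Hv]|Hout].
    2:{ exists (mkposreal 1 Rlt_0_1). tauto. }
    destruct (Req_dec (f u v) 0) as [Hfz|Hfz].
    - assert (Hgz : g u v <> 0) by (intros Hgz; apply Hno; eauto 10).
      destruct (sign_locally_constant g u v (Hg u v Hu Hv) Hgz) as [e He].
      exists (pos_div_2 e). intros _ _. right. intros x y Hx Hy.
      simpl in Hx, Hy. apply He; lra.
    - destruct (sign_locally_constant f u v (Hf u v Hu Hv) Hfz) as [e He].
      exists (pos_div_2 e). intros _ _. left. intros x y Hx Hy.
      simpl in Hx, Hy. apply He; lra. }
  assert (Hchoice : exists delta : R -> R -> posreal, forall u v,
    a <= u <= b -> c <= v <= d ->
    (forall x y, Rabs (x - u) < 2 * delta u v -> Rabs (y - v) < 2 * delta u v ->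
       0 < f x y * f u v) \/
    (forall x y, Rabs (x - u) < 2 * delta u v -> Rabs (y - v) < 2 * delta u v ->
       0 < g x y * g u v)).
  { exists (fun u v =>
      proj1_sig (constructive_indefinite_description _ (Hdelta u v))).
    intros u v.
    exact (proj2_sig (constructive_indefinite_description _ (Hdelta u v))). }
  clear Hdelta. destruct Hchoice as [delta Hdelta].
  destruct (compactness_value_2d a b c d delta) as [r Hr].
  destruct (INR_archimed r ((b - a) + (d - c)) (cond_pos r)) as [n Hn].
  assert (Hr0 := cond_pos r).
  assert (Hn0 : (0 < n)%nat).
  { destruct n; [simpl in Hn; lra|lia]. }
  assert (HnR := lt_0_INR _ Hn0).
  assert (Hmesh : forall w, 0 <= w -> w <= (b - a) + (d - c) ->
                    0 <= w / INR n < r).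
  { intros w Hw0 Hw. split; [apply Rdiv_le_0_compat; lra|].
    apply Rlt_div_l; lra. }
  destruct (Hmesh (b - a)) as [Hmx0 Hmx]; [lra|lra|].
  destruct (Hmesh (d - c)) as [Hmy0 Hmy]; [lra|lra|].
  set (X := node a b n). set (Y := node c d n).
  destruct (mixed_cell n n (fun i j => low n i (f (X i) (Y j)))
              (fun i j => low n j (g (X i) (Y j)))) as (i & j & Hi & Hj & HL & HB).
  - intros; apply low_0.
  - intros; now apply low_n.
  - intros; apply low_0.
  - intros; now apply low_n.
  - assert (HX : forall p, (p <= n)%nat -> a <= X p <= b)
      by (intros; now apply node_bounds).
    assert (HY : forall q, (q <= n)%nat -> c <= Y q <= d)
      by (intros; now apply node_bounds).
    apply (Hr (X i) (Y j)); [apply HX; lia|apply HY; lia|].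
    intros (u & v & Hu & Hv & Hxu & Hyv & Hd).
    assert (Hclose : forall p q, (p = i \/ p = S i) -> (q = j \/ q = S j) ->
      Rabs (X p - u) < 2 * delta u v /\ Rabs (Y q - v) < 2 * delta u v).
    { apply Rabs_def2 in Hxu. apply Rabs_def2 in Hyv.
      intros p q [->| ->] [->| ->]; unfold X, Y in *; rewrite ?node_S;
        split; apply Rabs_def1; lra. }
    destruct (Hdelta u v Hu Hv) as [Hs|Hs].
    + destruct (in_corners _ _ _ _ (HL true)) as (p & q & Hp & Hq & Hlow).
      destruct (in_corners _ _ _ _ (HL false)) as (p' & q' & Hp' & Hq' & Hhigh).
      apply low_true in Hlow.
      2:{ intros ->. unfold X. rewrite node_0. apply Hleft, HY. lia. }
      apply low_false in Hhigh.
      2:{ intros ->. unfold X. rewrite node_n by assumption.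
          apply Hright, HY. lia. }
      destruct (Hclose p q Hp Hq). destruct (Hclose p' q' Hp' Hq').
      apply (no_common_sign (f (X p) (Y q)) (f (X p') (Y q')) (f u v)); auto.
    + destruct (in_corners _ _ _ _ (HB true)) as (p & q & Hp & Hq & Hlow).
      destruct (in_corners _ _ _ _ (HB false)) as (p' & q' & Hp' & Hq' & Hhigh).
      apply low_true in Hlow.
      2:{ intros ->. unfold Y. rewrite node_0. apply Hbottom, HX. lia. }
      apply low_false in Hhigh.
      2:{ intros ->. unfold Y. rewrite node_n by assumption.
          apply Htop, HX. lia. }
      destruct (Hclose p q Hp Hq). destruct (Hclose p' q' Hp' Hq').
      apply (no_common_sign (g (X p) (Y q)) (g (X p') (Y q')) (g u v)); auto.
Qed.

(** * The cubic equation in the complex plane *)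

Lemma continuity_2d_Re (h : C -> C) (x y : R) :
  continuous h (x, y) -> continuity_2d_pt (fun x y => Re (h (x, y))) x y.
Proof.
  intros Hh. apply continuity_2d_pt_filterlim.
  apply filterlim_ext with (fun z : C => fst (h z)); [now intros []|].
  apply (filterlim_comp _ _ _ h fst _ _ _ Hh).
  destruct (h (x, y)) as [p q]. apply (continuous_fst p q).
Qed.

Lemma continuity_2d_Im (h : C -> C) (x y : R) :
  continuous h (x, y) -> continuity_2d_pt (fun x y => Im (h (x, y))) x y.
Proof.
  intros Hh. apply continuity_2d_pt_filterlim.
  apply filterlim_ext with (fun z : C => snd (h z)); [now intros []|].
  apply (filterlim_comp _ _ _ h snd _ _ _ Hh).
  destruct (h (x, y)) as [p q]. apply (continuous_snd p q).
Qed.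

Lemma Cmod_sqr (x y : R) : Cmod (x, y) ^ 2 = x ^ 2 + y ^ 2.
Proof. unfold Cmod; simpl fst; simpl snd. apply pow2_sqrt. nra. Qed.

Lemma subcubic_bound (h : C -> C) (e : R) :
  filterlim (fun z : C => (h z / RtoC (Cmod z ^ 3))%C)
    C_infty (locally (RtoC 0)) ->
  0 < e ->
  exists M, 0 < M /\ forall z, M <= Cmod z ->
    Rabs (Re (h z)) <= e * Cmod z ^ 3 /\ Rabs (Im (h z)) <= e * Cmod z ^ 3.
Proof.
  intros Hlim He.
  destruct (proj1 (filterlim_locally _ _) Hlim (mkposreal e He)) as [M HM].
  exists (Rmax M 0 + 1).
  assert (HM0 := Rmax_l M 0). assert (H0 := Rmax_r M 0).
  split; [lra|]. intros z Hz.
  assert (Hz3 : 0 < Cmod z ^ 3) by (apply pow_lt; lra).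
  destruct (HM z) as [Hre Him]; [lra|].
  set (t := Cmod z ^ 3) in *.
  set (w := (h z / RtoC t)%C) in *.
  assert (Hw : h z = (t * Re w, t * Im w)).
  { assert (Hm : h z = (RtoC t * w)%C).
    { unfold w. field. intros Ht. apply RtoC_inj in Ht. lra. }
    rewrite Hm. unfold Cmult, RtoC, Re, Im; simpl. f_equal; ring. }
  change (Rabs (Re w - 0) < e) in Hre. change (Rabs (Im w - 0) < e) in Him.
  rewrite Rminus_0_r in Hre, Him.
  rewrite Hw.
  change (Rabs (t * Re w) <= e * t /\ Rabs (t * Im w) <= e * t).
  rewrite !Rabs_mult, (Rabs_pos_eq t), (Rmult_comm e) by lra.
  split; apply Rmult_le_compat_l; lra.
Qed.

(** Holds because [|z| <= 2 * M] in the square of half-side [M].  On a side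
    where a coordinate equals [M] or [-M], the right-hand side is the absolute
    value of the cubic term in that coordinate, which thus dominates any
    perturbation of size at most [|z|^3 / 2]. *)
Lemma Cmod_cube_le (M x y : R) :
  Rabs x <= M -> Rabs y <= M -> Cmod (x, y) ^ 3 / 2 <= (x ^ 2 + y ^ 2) * M.
Proof.
  intros Hx Hy. rewrite <- Cmod_sqr.
  assert (H0 := Cmod_ge_0 (x, y)).
  assert (HM : Cmod (x, y) <= 2 * M).
  { assert (Hx2 := pow_maj_Rabs M x 2 Hx).
    assert (Hy2 := pow_maj_Rabs M y 2 Hy).
    assert (HM := Rle_trans _ _ _ (Rabs_pos x) Hx).
    apply Rsqr_incr_0_var; [|lra]. rewrite !Rsqr_pow2, Cmod_sqr. nra. }
  assert (H2 := pow_le _ 2 H0).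
  replace (Cmod (x, y) ^ 3) with (Cmod (x, y) ^ 2 * Cmod (x, y)) by ring.
  nra.
Qed.

Lemma cubic_equation_solvable (gamma : R) (hgamma : gamma <> 0) (h : C -> C)
    (hcont : forall z : C, continuous h z)
    (hlim : filterlim (fun z : C => (h z / RtoC (Cmod z ^ 3))%C)
              C_infty (locally (RtoC 0))) :
  exists z : C, (RtoC gamma * RtoC (Cmod z ^ 2) * z)%C = h z.
Proof.
  assert (Hg0 := Rabs_pos_lt _ hgamma).
  destruct (subcubic_bound h (Rabs gamma / 2) hlim) as (M & HM0 & HM); [lra|].
  assert (Hquot : forall s z, Rabs s <= Rabs gamma / 2 * Cmod z ^ 3 ->
    - (Cmod z ^ 3 / 2) <= s / gamma <= Cmod z ^ 3 / 2).
  { intros s z Hs. apply Rabs_le_between.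
    rewrite Rabs_div by assumption. apply Rle_div_l; lra. }
  assert (Hsq : forall x y, continuity_2d_pt (fun x y => x ^ 2 + y ^ 2) x y).
  { intros x y.
    apply continuity_2d_pt_ext with (fun x y => x * x + y * y);
      [intros; ring|].
    apply continuity_2d_pt_plus; apply continuity_2d_pt_mult;
      auto using continuity_2d_pt_id1, continuity_2d_pt_id2. }
  assert (Hside : forall x y, Rabs x <= M -> Rabs y <= M ->
    Rabs x = M \/ Rabs y = M ->
    - ((x ^ 2 + y ^ 2) * M) <= Re (h (x, y)) / gamma <= (x ^ 2 + y ^ 2) * M /\
    - ((x ^ 2 + y ^ 2) * M) <= Im (h (x, y)) / gamma <= (x ^ 2 + y ^ 2) * M).
  { intros x y Hx Hy HxyM.
    assert (Hc := Cmod_cube_le M x y Hx Hy).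
    assert (Hmax := Rmax_Cmod (x, y)). simpl in Hmax.
    assert (Hl := Rmax_l (Rabs x) (Rabs y)).
    assert (Hr := Rmax_r (Rabs x) (Rabs y)).
    destruct (HM (x, y)) as [Hre Him]; [lra|].
    apply Hquot in Hre. apply Hquot in Him. lra. }
  assert (HMM : Rabs M = M) by (apply Rabs_pos_eq; lra).
  assert (HMN : Rabs (- M) = M) by (now rewrite Rabs_Ropp).
  destruct (poincare_miranda
    (fun x y => (x ^ 2 + y ^ 2) * x - Re (h (x, y)) * / gamma)
    (fun x y => (x ^ 2 + y ^ 2) * y - Im (h (x, y)) * / gamma)
    (- M) M (- M) M) as (x & y & _ & _ & Hx & Hy); [lra|lra| | | | | | |].
  1,2: intros x y _ _; apply continuity_2d_pt_minus;
    apply continuity_2d_pt_mult;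
    auto using continuity_2d_pt_id1, continuity_2d_pt_id2,
      continuity_2d_pt_const, continuity_2d_Re, continuity_2d_Im.
  1-2: intros y Hy; apply Rabs_le_between in Hy.
  3-4: intros x Hx; apply Rabs_le_between in Hx.
  - destruct (Hside (- M) y) as [H _]; [lra|lra|lra|]. unfold Rdiv in H. lra.
  - destruct (Hside M y) as [H _]; [lra|lra|lra|]. unfold Rdiv in H. lra.
  - destruct (Hside x (- M)) as [_ H]; [lra|lra|lra|]. unfold Rdiv in H. lra.
  - destruct (Hside x M) as [_ H]; [lra|lra|lra|]. unfold Rdiv in H. lra.
  - exists (x, y). rewrite Cmod_sqr.
    assert (Hre : Re (h (x, y)) = gamma * ((x ^ 2 + y ^ 2) * x)).
    { replace ((x ^ 2 + y ^ 2) * x) with (Re (h (x, y)) * / gamma) by lra.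
      now field. }
    assert (Him : Im (h (x, y)) = gamma * ((x ^ 2 + y ^ 2) * y)).
    { replace ((x ^ 2 + y ^ 2) * y) with (Im (h (x, y)) * / gamma) by lra.
      now field. }
    rewrite (surjective_pairing (h (x, y))).
    change (fst (h (x, y))) with (Re (h (x, y))).
    change (snd (h (x, y))) with (Im (h (x, y))).
    rewrite Hre, Him. unfold Cmult, RtoC; simpl. f_equal; ring.
Qed.

Theorem proposition2p6 (K : nat) (hK : (2 <= K)%nat)
    (eps : R) (heps : (0 < eps)%R)
    (gamma : R) (hgamma : gamma <> 0%R)
    (h : C -> C) (hcont : forall z : C, continuous h z)
    (hlim : filterlim (fun z : C => (h z / RtoC (Cmod z ^ 3))%C)
              C_infty (locally (RtoC 0))) :
  exists u : Z -> C,
    periodic K u /\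
    forall k : Z,
      (RtoC eps * fwd_diff (fwd_diff u) (k - 1)%Z
         + RtoC gamma * RtoC (Cmod (u k) ^ 2) * u k)%C = h (u k).
Proof.
  destruct (cubic_equation_solvable gamma hgamma h hcont hlim) as [z Hz].
  exists (fun _ => z). split; [now intros k|].
  intros k. rewrite Hz, fwd_diff2_pred. ring.
Qed.
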